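(* Let $G$ be a connected graph and let $u,v\in V(G)$ with $d_G(u)\ge 2$ and $d_G(v)\ge 2$. Let $s\ge 0$ be an integer and suppose $u$ and $v$ are joined in $G$ by a path $w_0w_1\cdots w_s$ with $w_0=v$, $w_s=u$ and $d_G(w_i)=2$ for $1\le i\le s-1$ (when $s=0$ this means $u=v$). For nonnegative integers $p,q$, let $G_{p,s,q}(u,v)$ denote the graph obtained from $G$ by attaching a pendent path with $p$ new vertices to $u$ and a pendent path with $q$ new vertices to $v$ (when $s=0$ both paths are attached at the same vertex $v=u$). Let $0\le\alpha<1$. If $p-q\ge\max\{s+1,2\}$, then $$\rho_{\alpha}(G_{p-1,s,q+1}(u,v))>\rho_{\alpha}(G_{p,s,q}(u,v)).$$
   Context: For a graph $H$ with adjacency matrix $A(H)$ and diagonal degree matrix $D(H)$, and $\alpha\in[0,1]$, define $A_{\alpha}(H)=\alpha D(H)+(1-\alpha)A(H)$, and let $\rho_{\alpha}(H)$ denote the spectral radius of $A_{\alpha}(H)$. Attaching a pendent path with $m$ new vertices to a vertex $x$ means adding new vertices $y_1,\dots,y_m$ with edges $y_1y_2,\dots,y_{m-1}y_m$ and $y_mx$ (nothing is added if $m=0$). *)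

(* Defs.v *)
From mathcomp Require Import all_boot all_order all_algebra.
From mathcomp Require Import classical_sets reals complex.

Set Implicit Arguments.
Unset Strict Implicit.
Unset Printing Implicit Defensive.

Import Order.TTheory GRing.Theory Num.Theory.

Record sgraph := SGraph {
  svertex :> finType;
  sedge : rel svertex;
  sedge_sym : symmetric sedge;
  sedge_irrefl : irreflexive sedge }.

Arguments sedge {s}.

Notation "x -- y" := (sedge x y) (at level 30).

Definition deg (G : sgraph) (x : G) : nat := #|[set y | x -- y]|.

Definition connected_graph (G : sgraph) : Prop :=
  forall x y : G, connect sedge x y.

Section AttachPath.
Variables (G : sgraph) (x : G) (m : nat).

(* The new vertex [inr i] is y_(i+1), so that y_m is the one with i.+1 = m. *)
Definition attach_rel : rel (G + 'I_m)%type := fun a b =>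
  match a, b with
  | inl a, inl b => a -- b
  | inr i, inr j => (i.+1 == j :> nat) || (j.+1 == i :> nat)
  | inl a, inr i | inr i, inl a => (a == x) && (i.+1 == m)
  end.

Lemma attach_rel_sym : symmetric attach_rel.
Proof. by case=> [a|i] [b|j] //=; [exact: sedge_sym | rewrite orbC]. Qed.

Lemma attach_rel_irrefl : irreflexive attach_rel.
Proof.
by case=> [a|i] /=; [exact: sedge_irrefl | rewrite orbb gtn_eqF].
Qed.

Definition attach_path : sgraph := SGraph attach_rel_sym attach_rel_irrefl.

End AttachPath.

(* The graph G_{p,s,q}(u,v); the integer s is determined by G, u and v and does
   not enter the construction. *)
Definition attach_two_paths (G : sgraph) (u v : G) (p q : nat) : sgraph :=
  @attach_path (attach_path u p) (inl v) q.

Local Open Scope classical_set_scope.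
Local Open Scope ring_scope.

Section AlphaMatrix.
Variable R : realType.

(* Vertices are numbered by [enum_val]; the choice of numbering only changes
   these matrices by a simultaneous permutation of rows and columns. *)
Definition adjacency_mx (G : sgraph) : 'M[R]_#|G| :=
  \matrix_(i, j) (enum_val i -- enum_val j)%:R.

Definition degree_mx (G : sgraph) : 'M[R]_#|G| :=
  diag_mx (\row_i (deg (enum_val i))%:R).

Definition alpha_mx (alpha : R) (G : sgraph) : 'M[R]_#|G| :=
  alpha *: degree_mx G + (1 - alpha) *: adjacency_mx G.

(* Largest modulus of a complex eigenvalue. For n > 0 the set below is finite
   and nonempty, so the supremum is a maximum. *)
Definition spectral_radius (n : nat) (A : 'M[R]_n) : R :=
  sup [set Normc.normc z | z in
         [set z : R[i] | eigenvalue (map_mx (real_complex R) A) z]].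

Definition rho (alpha : R) (G : sgraph) : R :=
  spectral_radius (alpha_mx alpha G).

End AlphaMatrix.

(* Main.v *)
Require Import Defs.
From mathcomp Require Import all_boot all_order all_algebra.
From mathcomp Require Import classical_sets reals complex.
From mathcomp Require Import ring lra zify.

Set Implicit Arguments.
Unset Strict Implicit.
Unset Printing Implicit Defensive.

Import Order.TTheory GRing.Theory Num.Theory.
Local Open Scope ring_scope.

(* Let x be the Perron vector of G_{p,s,q}, with eigenvalue r. Along a pendent
   path x is proportional, counting from the free end, to the sequence with
   a_0 = - beta, a_1 = 1 and a_(k+2) = t a_(k+1) - a_k, where
   beta = alpha / (1 - alpha) and t = (r - 2 alpha) / (1 - alpha). Keep x on G
   and put multiples of a on the pendent paths of G_{p-1,s,q+1}: this vector y
   is an r-eigenvector except at u and v, and, since a_(k+1)^2 - a_k a_(k+2) is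
   a constant C > 0,
     <y, A y> - r <y, y> = (1 - alpha) C
        (x_v^2 / (a_(q+1) a_(q+2)) - x_u^2 / (a_p a_(p+1))).
   By Rayleigh's principle it is enough that the right-hand side is positive.
   The products a_k a_(k+1) increase for k <= p because u has two neighbours
   in G besides its pendent path. Along w_0 ... w_s the vector x solves the same
   recurrence as a, and the extra neighbour of v makes it fall short of the
   continuation of the pendent path at v by an explicit amount, which bounds
   x_u / x_v from above well enough. *)

(** * Spectral radius of a symmetric matrix *)

Section ComplexModulus.
Variable R : realType.

Lemma normC_normc (z : R[i]) : `|z| = (Normc.normc z)%:C%C.
Proof. by case: z => a b; rewrite normc_def. Qed.

Lemma realC (x : R) : x%:C%C \is Num.real.
Proof. by rewrite realE !lecR le_total. Qed.

Lemma normc_ge0 (z : R[i]) : 0 <= Normc.normc z.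
Proof. by case: z => a b; rewrite sqrtr_ge0. Qed.

Lemma seq_max_exists (T : eqType) (f : T -> R) (r : seq T) :
  r != [::] -> exists2 z, z \in r & forall y, y \in r -> f y <= f z.
Proof.
elim: r => // x [|x' r] IHr _.
  by exists x => [|y]; rewrite inE // => /eqP ->.
have [//|z zr zmax] := IHr.
have [fxz|fzx] := leP (f x) (f z).
  by exists z => [|y]; rewrite inE ?zr ?orbT // => /predU1P[->|/zmax].
exists x => [|y]; rewrite inE ?eqxx // => /predU1P[->//|/zmax fyz].
by rewrite (le_trans fyz) ?ltW.
Qed.

End ComplexModulus.

Section SymmetricMatrix.
Local Open Scope sesquilinear_scope.
Variables (R : realType) (n : nat) (A : 'M[R]_n).
Let AC : 'M[R[i]]_n := map_mx (real_complex R) A.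

(** The supremum is attained: the characteristic polynomial splits over R[i], so the eigenvalues
    form a finite list, nonempty when n > 0. *)
Lemma spectral_radius_max : (0 < n)%N ->
  (exists2 z, eigenvalue AC z & spectral_radius A = Normc.normc z) /\
  (forall z, eigenvalue AC z -> Normc.normc z <= spectral_radius A).
Proof.
move=> n_gt0; have [r chE] := closed_field_poly_normal (char_poly AC).
rewrite (monicP (char_poly_monic AC)) scale1r in chE.
have eigE z : eigenvalue AC z = (z \in r).
  by rewrite eigenvalue_root_char chE root_prod_XsubC.
have r_neq0 : r != [::].
  apply: contraTneq n_gt0 => r0; move: (size_char_poly AC).
  by rewrite chE r0 big_nil size_poly1 => -[<-].
have [z zr zmax] := seq_max_exists (@Normc.normc R) r_neq0.
have zub : ubound [set Normc.normc z | z in [set z | eigenvalue AC z]]%classic (Normc.normc z).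
  by move=> _ [y /= + <-]; rewrite eigE => /zmax.
have zin : [set Normc.normc z | z in [set z | eigenvalue AC z]]%classic (Normc.normc z).
  by exists z; rewrite //= eigE.
have srE : spectral_radius A = Normc.normc z.
  apply/le_anti/andP; split; first by apply: ge_sup => //; exists (Normc.normc z).
  by apply: ub_le_sup => //; exists (Normc.normc z).
split; first by exists z; rewrite ?eigE.
by move=> y yA; rewrite srE zmax -?eigE.
Qed.

Hypothesis A_sym : forall i j, A i j = A j i.

(** Diagonalise A over R[i] by a unitary P. In the coordinates v the form is the sum of D_i |v_i|^2,
    and each D_i is a real eigenvalue, hence at most the spectral radius. *)
Lemma rayleigh_le (y : 'I_n -> R) : (0 < n)%N ->
  \sum_i y i * (\sum_j A i j * y j) <= spectral_radius A * \sum_i y i ^+ 2.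
Proof.
move=> n_gt0; have [_ sr_max] := spectral_radius_max n_gt0.
have A_herm : AC \is hermsymmx.
  apply: realsym_hermsym.
    by apply/is_hermitianmxP/matrixP=> i j; rewrite !mxE expr0 mul1r A_sym.
  by apply/mxOverP => i j; rewrite mxE realC.
have D_real := hermitian_spectral_diag_real A_herm.
have /hermitian_normalmx/orthomx_spectralP := A_herm.
move: (spectral_unitarymx AC) D_real.
set P := spectralmx AC; set D := spectral_diag AC => P_unit D_real.
rewrite invmx_unitary // => AE.
have PPt : P *m P^t* = 1%:M by apply/unitarymxP.
have PtP : P^t* *m P = 1%:M by apply: mulmx1C.
have D_le i : D 0 i <= (spectral_radius A)%:C%C.
  have /mxOverP/(_ 0 i) Di_real := D_real.
  apply: le_trans (real_ler_norm Di_real) _; rewrite normC_normc lecR; apply: sr_max.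
  apply/eigenvalueP; exists (row i P); last first.
    apply: contraTneq isT => Pi0; have /rowP/(_ i) := congr1 (row i) PPt.
    by rewrite row_mul Pi0 mul0mx !mxE eqxx => /eqP; rewrite eq_sym oner_eq0.
  rewrite AE -row_mul 2!mulmxA PPt mul1mx; apply/rowP=> j.
  by rewrite row_mul row_diag_mx -scalemxAl -rowE !mxE.
pose u : 'rV[R[i]]_n := \row_i (y i)%:C%C.
pose v := u *m P^t*.
have vvE : \sum_i `|v 0 i| ^+ 2 = (\sum_i y i ^+ 2)%:C%C.
  have : (v *m v^t*) 0 0 = (u *m u^t*) 0 0.
    by rewrite trmx_mul map_mxM trmxCK -mulmxA (mulmxA _ P) PtP mul1mx.
  rewrite !mxE => vu; rewrite rmorph_sum /=.
  rewrite (eq_bigr (fun i => v 0 i * v^t* i 0)); last first.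
    by move=> i _; rewrite normCK [v^t* _ _]mxE [v^T _ _]mxE.
  rewrite vu; apply: eq_bigr => i _.
  by rewrite !mxE rmorphXn /= expr2; congr (_ * _); apply/CrealP/realC.
have uAuE : \sum_i D 0 i * `|v 0 i| ^+ 2 = (\sum_i y i * (\sum_j A i j * y j))%:C%C.
  have : (v *m diag_mx D *m v^t*) 0 0 = (u *m AC *m u^t*) 0 0.
    by rewrite trmx_mul map_mxM trmxCK /v AE !mulmxA.
  rewrite mxE [RHS]mxE => vu; rewrite rmorph_sum /=.
  transitivity (\sum_i (v *m diag_mx D) 0 i * v^t* i 0).
    apply: eq_bigr => i _; rewrite normCK mul_mx_diag [v^t* _ _]mxE [v^T _ _]mxE mxE.
    by rewrite [RHS]mulrAC mulrC.
  rewrite vu; apply: eq_bigr => i _; rewrite rmorphM rmorph_sum /= mulrC; congr (_ * _).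
    by rewrite !mxE; apply/CrealP/realC.
  by rewrite mxE; apply: eq_bigr => j _; rewrite !mxE rmorphM /= A_sym mulrC.
rewrite -lecR -uAuE rmorphM /= -vvE mulr_sumr; apply: ler_sum => i _.
by rewrite ler_wpM2r // exprn_ge0.
Qed.

Hypothesis A_ge0 : forall i j, 0 <= A i j.

(* First variation of the Rayleigh quotient at [y] in the direction [L y]. *)
Lemma rayleigh_eq_eigenvector (y : 'I_n -> R) : (0 < n)%N ->
  \sum_i y i * (\sum_j A i j * y j) = spectral_radius A * \sum_i y i ^+ 2 ->
  forall i, \sum_j A i j * y j = spectral_radius A * y i.
Proof.
move=> n_gt0 yE; set r := spectral_radius A in yE *.
pose L (w : 'I_n -> R) i := \sum_j A i j * w j - r * w i.
pose Q w := \sum_i w i * L w i.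
have QE w : Q w = \sum_i w i * (\sum_j A i j * w j) - r * \sum_i w i ^+ 2.
  rewrite mulr_sumr -sumrB; apply: eq_bigr => i _.
  by rewrite /L mulrBr expr2 mulrCA.
have Q_le0 w : Q w <= 0 by rewrite QE subr_le0 rayleigh_le.
have Qy0 : Q y = 0 by rewrite QE yE subrr.
have L_sym w : \sum_i y i * L w i = \sum_i w i * L y i.
  rewrite (eq_bigr (fun i => \sum_j y i * (A i j * w j) - r * (y i * w i))); last first.
    by move=> k _; rewrite mulrBr mulr_sumr (mulrCA (y k)).
  rewrite [RHS](eq_bigr (fun i => \sum_j w i * (A i j * y j) - r * (y i * w i))); last first.
    by move=> k _; rewrite mulrBr mulr_sumr (mulrCA (w k)) (mulrC (w k)).
  rewrite !sumrB exchange_big /=; congr (_ - _); apply: eq_bigr => i _.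
  by apply: eq_bigr => j _; rewrite (A_sym j i) mulrC mulrAC mulrC.
pose S := \sum_i L y i ^+ 2.
have yLLy : \sum_i y i * L (L y) i = S.
  by rewrite L_sym; apply: eq_bigr => i _; rewrite expr2.
have S_ge0 : 0 <= S by apply: sumr_ge0 => i _; exact: sqr_ge0.
have LD z w e i : L (fun i => z i + e * w i) i = L z i + e * L w i.
  rewrite /L (eq_bigr (fun j => A i j * z j + e * (A i j * w j))); last first.
    by move=> j _; ring.
  by rewrite big_split -mulr_sumr /=; ring.
have QD e : Q (fun i => y i + e * L y i) = 2 * e * S + e ^+ 2 * Q (L y).
  have -> : Q (fun i => y i + e * L y i) =
      \sum_i (y i * L y i + e * (y i * L (L y) i) + e * (L y i ^+ 2) +
              e ^+ 2 * (L y i * L (L y) i)).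
    apply: eq_bigr => i _.
    rewrite LD; ring.
  rewrite !big_split -!mulr_sumr /= yLLy -/(Q y) Qy0 -/(Q (L y)) -/S; ring.
have S0 : S = 0.
  apply/eqP; rewrite eq_le S_ge0 andbT leNgt; apply/negP => S_gt0.
  have k_gt0 : 0 < 1 - Q (L y) by have := Q_le0 (L y); lra.
  (* For S > 0, the value 2 e S + e^2 Q(L y) is positive for small e > 0; this e is small enough,
     and Q(L y) <= 0 keeps its denominator positive. *)
  have := Q_le0 (fun i => y i + S / (1 - Q (L y)) * L y i); rewrite QD.
  have -> : 2 * (S / (1 - Q (L y))) * S + (S / (1 - Q (L y))) ^+ 2 * Q (L y) =
     (S / (1 - Q (L y))) ^+ 2 * (2 - Q (L y)) by field; rewrite gt_eqF.
  apply/negP; rewrite -ltNge mulr_gt0 ?exprn_gt0 ?divr_gt0 //.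
  by have := Q_le0 (L y); lra.
move=> i; apply/eqP; rewrite -subr_eq0 -sqrf_eq0.
by have /psumr_eq0P -> // := S0 => j _; exact: sqr_ge0.
Qed.

(** Take the moduli x of an eigenvector for an eigenvalue of largest modulus r. The triangle
    inequality gives r x <= A x entrywise, so x attains the Rayleigh bound and is itself an
    eigenvector. *)
Lemma perron_vector : (0 < n)%N -> exists x : 'I_n -> R,
  [/\ forall i, 0 <= x i, exists i, x i != 0 &
      forall i, \sum_j A i j * x j = spectral_radius A * x i].
Proof.
move=> n_gt0; have [[z /eigenvalueP[v vA v_neq0] srE] _] := spectral_radius_max n_gt0.
pose x i := Normc.normc (v 0 i).
have x_ge0 i : 0 <= x i by exact: normc_ge0.
exists x; split=> //.
  have /rV0Pn[i vi] := v_neq0; exists i.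
  by apply: contraNneq vi => /Normc.eq0_normc ->.
have sub i : spectral_radius A * x i <= \sum_j A i j * x j.
  rewrite srE -Normc.normcM; have /rowP/(_ i) := vA; rewrite [in RHS]mxE => <-.
  rewrite -lecR -normC_normc mxE rmorph_sum /=; apply: le_trans (ler_norm_sum _ _ _) _.
  apply: ler_sum => j _; rewrite normrM mxE rmorphM /= -normC_normc mulrC A_sym.
  by rewrite ger0_norm ?lecR.
apply: rayleigh_eq_eigenvector => //; apply/le_anti; rewrite rayleigh_le //= mulr_sumr.
apply: ler_sum => i _; rewrite expr2 mulrCA.
exact: ler_wpM2l.
Qed.

End SymmetricMatrix.

(** * The operator of [alpha_mx] on vertex functions *)

Section AlphaOperator.
Variables (R : realType) (alpha : R).

(** The degree term is spread over the edges at x, so that a new edge at x simply adds a summand. *)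
Definition alpha_op (G : sgraph) (f : G -> R) (x : G) : R :=
  \sum_(y | x -- y) (alpha * f x + (1 - alpha) * f y).

Lemma alpha_mxE (G : sgraph) (f : G -> R) (i : 'I_#|G|) :
  \sum_j alpha_mx alpha G i j * f (enum_val j) = alpha_op f (enum_val i).
Proof.
rewrite /alpha_op big_split sumr_const -mulr_sumr /=.
rewrite (eq_bigr (fun j => (i == j)%:R * (alpha * (deg (enum_val i))%:R * f (enum_val j)) +
  (1 - alpha) * ((enum_val i -- enum_val j)%:R * f (enum_val j)))); last first.
  by move=> j _; rewrite !mxE mulrDl -mulr_natl; ring.
rewrite big_split -mulr_sumr /=; congr (_ + _ * _).
  rewrite (bigD1 i) //= big1 => [|j]; last by rewrite eq_sym => /negPf->; rewrite mul0r.
  by rewrite eqxx mul1r addr0 /deg cardsE -[RHS]mulr_natr mulrAC.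
rewrite [RHS]big_mkcond (reindex _ (onW_bij _ (@enum_val_bij G))) /=.
by apply: eq_bigr => j _; case: sedge; rewrite ?mul1r ?mul0r.
Qed.

Lemma alpha_mx_sym (G : sgraph) i j : alpha_mx alpha G i j = alpha_mx alpha G j i.
Proof.
rewrite !mxE sedge_sym eq_sym; congr (_ * _ + _).
by case: eqP => // ->.
Qed.

(** Rayleigh's principle in residual form: vertices where f satisfies the r-equation contribute
    nothing to the sum. *)
Lemma alpha_op_gt_rho (G : sgraph) (f : G -> R) (r : R) :
  0 < \sum_x f x * (alpha_op f x - r * f x) -> r < rho alpha G.
Proof.
move=> fr; have G_gt0 : (0 < #|G|)%N.
  rewrite lt0n; apply: contraTneq fr => /card0_eq G0.
  by rewrite big_pred0 ?ltxx // => x; have := G0 x; rewrite !inE.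
have := rayleigh_le (@alpha_mx_sym G) (fun i => f (enum_val i)) G_gt0.
rewrite (eq_bigr _ (fun i _ => congr1 (fun a => f (enum_val i) * a) (alpha_mxE f i))).
have reE (F : G -> R) : \sum_(i < #|G|) F (enum_val i) = \sum_x F x.
  by rewrite [RHS](reindex _ (onW_bij _ (@enum_val_bij G))).
rewrite (reE (fun x => f x * alpha_op f x)) (reE (fun x => f x ^+ 2)) -/(rho alpha G) => ray.
have S_ge0 : 0 <= \sum_x f x ^+ 2 by apply: sumr_ge0 => x _; exact: sqr_ge0.
rewrite ltNge; apply/negP => rho_le.
move: fr; rewrite (eq_bigr (fun x => f x * alpha_op f x - r * f x ^+ 2)); last first.
  by move=> x _; rewrite mulrBr expr2 (mulrCA (f x)).
rewrite sumrB -mulr_sumr subr_gt0 ltNge => /negP; apply.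
by rewrite (le_trans ray) // ler_wpM2r.
Qed.

Hypothesis alpha01 : 0 <= alpha < 1.

(** At a zero of a nonnegative eigenfunction the terms of the neighbours sum to zero, and alpha < 1
    makes the neighbours vanish too. By connectedness a single zero would spread to all of G. *)
Lemma perron (G : sgraph) (x0 : G) : connected_graph G ->
  exists2 f : G -> R, forall x, 0 < f x & forall x, alpha_op f x = rho alpha G * f x.
Proof.
have [al0 al1] := andP alpha01 => conn.
have G_gt0 : (0 < #|G|)%N by apply/card_gt0P; exists x0.
have A_ge0 i j : 0 <= alpha_mx alpha G i j.
  by rewrite !mxE addr_ge0 // mulr_ge0 ?mulrn_wge0 ?ler0n ?subr_ge0 // ltW.
have [x [x_ge0 [i0 xi0] xE]] := perron_vector (@alpha_mx_sym G) A_ge0 G_gt0.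
pose f z := x (enum_rank z).
have f_ge0 z : 0 <= f z by exact: x_ge0.
have fE z : alpha_op f z = rho alpha G * f z.
  rewrite -[z]enum_rankK -alpha_mxE {2}/f enum_rankK -[RHS]xE.
  by apply: eq_bigr => j _; rewrite /f enum_valK.
exists f => // z; rewrite lt_neqAle f_ge0 andbT eq_sym.
have f0_nbr a b : f a = 0 -> a -- b -> f b = 0.
  move=> fa0 ab; have := fE a; rewrite fa0 mulr0 /alpha_op.
  rewrite (eq_bigr (fun y => (1 - alpha) * f y)); last by move=> y _; rewrite fa0 mulr0 add0r.
  have nbr_ge0 y : 0 <= (1 - alpha) * f y by rewrite mulr_ge0 // subr_ge0 ltW.
  move=> /(psumr_eq0P (fun y _ => nbr_ge0 y))/(_ b ab)/eqP.
  by rewrite mulf_eq0 subr_eq0 gt_eqF //= => /eqP.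
have f_closed : closed sedge [pred a | f a == 0].
  apply: intro_closed; first exact: (sym_connect_sym (@sedge_sym G)).
  by move=> a b ab; rewrite !inE => /eqP fa; apply/eqP/(f0_nbr a b).
have := closed_connect f_closed (conn z (enum_val i0)).
by rewrite !inE /f enum_valK => ->.
Qed.

End AlphaOperator.

(** * The operator on a graph with a pendent path *)

Section AttachPathOperator.
Variables (R : realType) (alpha : R) (G : sgraph) (x : G) (m : nat).

(** The sum has at most one term, for the edge from x to y_m, and is empty when m = 0. *)
Definition attach_term (f : attach_path x m -> R) : R :=
  \sum_(i < m | i.+1 == m) (alpha * f (inl x) + (1 - alpha) * f (inr i)).

Lemma alpha_op_inl (f : attach_path x m -> R) (a : G) :
  alpha_op alpha f (inl a) =
    alpha_op alpha (fun b => f (inl b)) a + (a == x)%:R * attach_term f.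
Proof.
rewrite /alpha_op big_sumType /=; congr (_ + _); rewrite /attach_term.
by case: eqP => [->|_]; rewrite ?mul1r // mul0r big_pred0.
Qed.

Lemma sum_ord_pred1 (k : nat) (F : nat -> R) :
  \sum_(j < m | k == j) F j = if (k < m)%N then F k else 0.
Proof.
case: ltnP => [km|mk]; first by rewrite (big_pred1 (Ordinal km)) //= => j; rewrite eq_sym.
by rewrite big_pred0 // => j; rewrite gtn_eqF // (leq_trans (ltn_ord j)).
Qed.

Variables (f : attach_path x m -> R) (F : nat -> R).
Hypothesis F_path : forall i : 'I_m, f (inr i) = F i.+1.
Hypothesis F_root : f (inl x) = F m.+1.
(* [F 0] is the value at a virtual vertex beyond the free end, chosen so that the
   free end obeys the equation of the inner vertices; [m = 0] is then no exception. *)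
Hypothesis F_end : alpha * F 1%N + (1 - alpha) * F 0%N = 0.

Lemma attach_termE : attach_term f = alpha * F m.+1 + (1 - alpha) * F m.
Proof.
rewrite /attach_term; case: (posnP m) => [m0|m_gt0].
  rewrite big_pred0 => [|i]; last by have := ltn_ord i; lia.
  by rewrite m0 F_end.
rewrite (eq_bigl (fun i : 'I_m => m.-1 == i)); last by move=> i; lia.
rewrite (eq_bigr (fun i : 'I_m => alpha * F m.+1 + (1 - alpha) * F i.+1)) => [|i _].
  rewrite (sum_ord_pred1 m.-1 (fun j => alpha * F m.+1 + (1 - alpha) * F j.+1)).
  by rewrite prednK // leqnn.
by rewrite F_path F_root.
Qed.

Lemma alpha_op_inr (i : 'I_m) : alpha_op alpha f (inr i) =
  alpha *+ 2 * F i.+1 + (1 - alpha) * (F i + F i.+2).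
Proof.
pose X j := alpha * F i.+1 + (1 - alpha) * F j.+1.
rewrite /alpha_op big_sumType /=.
rewrite (eq_bigr (fun=> X m)) => [|a /andP[/eqP-> _]]; last by rewrite F_path F_root.
rewrite [in X in _ + X](eq_bigr (fun j : 'I_m => X j)) => [|j _]; last by rewrite !F_path.
have -> : \sum_(a | (a == x) && (i.+1 == m)) X m = if i.+1 == m then X m else 0.
  case: eqP => _; last by rewrite big_pred0 // => a; rewrite andbF.
  by rewrite (big_pred1 x) // => a; rewrite andbT.
rewrite (bigID (fun j : 'I_m => i.+1 == j)) /=.
rewrite (eq_bigl (fun j : 'I_m => i.+1 == j)); last by move=> j; lia.
rewrite [in X in _ + (_ + X)](eq_bigl (fun j : 'I_m => (0 < i)%N && (i.-1 == j)));
  last by move=> j; lia.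
have -> : \sum_(j < m | (0 < i)%N && (i.-1 == j)) X j = if (0 < i)%N then X i.-1 else 0.
  case: ltnP => _; last by rewrite big_pred0.
  by rewrite (sum_ord_pred1 i.-1 X) ifT //; have := ltn_ord i; lia.
rewrite (sum_ord_pred1 i.+1 X).
have -> : (if (0 < i)%N then X i.-1 else 0) = alpha * F i.+1 + (1 - alpha) * F i.
  by case: (posnP i) => [->|i_gt0]; rewrite ?F_end // /X prednK.
(* The neighbour on the side of the root is x itself when i.+1 = m and the next path vertex
   otherwise; in both cases its value is F i.+2. *)
have := ltn_ord i; rewrite leq_eqVlt; case: (eqVneq i.+1 m) => /= [im _|_ im].
  have -> : (i.+1 < m)%N = false by rewrite im ltnn.
  by rewrite -[in X m]im /X; ring.
by rewrite im /X; ring.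
Qed.

End AttachPathOperator.

Lemma attach_path_connected (G : sgraph) (x : G) (m : nat) :
  connected_graph G -> connected_graph (attach_path x m).
Proof.
move=> conn.
have symc : connect_sym (@sedge (attach_path x m)) by exact/sym_connect_sym/sedge_sym.
have inl_x a : connect (@sedge (attach_path x m)) (inl a) (inl x).
  have /connectP[s + ->] := conn a x.
  elim: s a => [|b s IHs] a /=; first by move=> _; exact: connect0.
  by case/andP=> ab /IHs; apply: connect_trans; apply: connect1.
have inr_x k : forall i : 'I_m, (m - i.+1 = k)%N ->
    connect (@sedge (attach_path x m)) (inr i) (inl x).
  elim: k => [|k IHk] i ik.
    by apply: connect1; rewrite /= eqxx /=; have := ltn_ord i; lia.
  have im : (i.+1 < m)%N by lia.
  apply: (connect_trans (connect1 _) (IHk (Ordinal im) _)); first by rewrite /= eqxx.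
  by rewrite /=; lia.
have to_x a : connect (@sedge (attach_path x m)) a (inl x).
  by case: a => [a|i]; [exact: inl_x | exact: (inr_x _ i erefl)].
by move=> a b; apply: connect_trans (to_x a) _; rewrite symc.
Qed.

(** * The recurrence along a path *)

Section LinearRecurrence.
Variables (R : realType) (t : R).

Fixpoint linrec (x0 x1 : R) (n : nat) : R :=
  if n is n'.+1 then linrec x1 (t * x1 - x0) n' else x0.

Lemma linrecSS x0 x1 n :
  linrec x0 x1 n.+2 = t * linrec x0 x1 n.+1 - linrec x0 x1 n.
Proof. by elim: n x0 x1 => // n IHn x0 x1; rewrite -IHn. Qed.

Lemma rec2_eq (F F' : nat -> R) (m : nat) :
  F 0%N = F' 0%N -> F 1%N = F' 1%N ->
  (forall i, (i.+2 <= m)%N -> F i.+2 = t * F i.+1 - F i) ->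
  (forall i, (i.+2 <= m)%N -> F' i.+2 = t * F' i.+1 - F' i) ->
  forall i, (i <= m)%N -> F i = F' i.
Proof.
move=> F0 F1 FS FS' i.
suff: ((i <= m)%N -> F i = F' i) /\ ((i.+1 <= m)%N -> F i.+1 = F' i.+1) by case.
elim: i => [|i [IH1 IH2]]; first by split=> _.
by split=> // im; rewrite FS // FS' // IH2 ?IH1 //; lia.
Qed.

Variable beta : R.
Local Notation a := (linrec (- beta) 1).
(** The solution vanishing at 0: its multiples are the differences of two solutions that agree
    there. *)
Local Notation U := (linrec 0 1).
Let C := 1 + beta * a 2%N.

Lemma linrec_casoratian n : a n.+1 ^+ 2 - a n * a n.+2 = C.
Proof.
elim: n => [|n IHn]; first by rewrite /C /=; ring.
by rewrite (linrecSS _ _ n.+1) -IHn (linrecSS _ _ n); ring.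
Qed.

(** The right-hand side is the Casoratian of a and its shift by s, hence independent of n. At n = 0
    it solves the recurrence in s with initial values 0 and C. *)
Lemma linrec_shift_casoratian n s :
  C * U s = a (n + s) * a n.+1 - a n * a (n + s).+1.
Proof.
elim: n => [|n ->]; last by rewrite !addSn !linrecSS; ring.
rewrite add0n; pose G k := a k * a 1%N - a 0%N * a k.+1.
apply: (@rec2_eq (fun k => C * U k) G s _ _ _ _ s (leqnn s)).
- by rewrite /G /=; ring.
- by rewrite /G /C /=; ring.
- by move=> i _; rewrite linrecSS; ring.
- by move=> i _; rewrite /G (linrecSS _ _ i.+1) (linrecSS _ _ i); ring.
Qed.

Variable p : nat.
Hypotheses (beta_ge0 : 0 <= beta) (p_gt0 : (0 < p)%N).
Hypothesis a_gt0 : forall k, (1 <= k <= p.+1)%N -> 0 < a k.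
(** This will come from the equation at u: the pendent path contributes a_p / a_(p+1), and each of
    two neighbours in G has value at least x_u / a_2. *)
Hypothesis t_ge : a p / a p.+1 + 2 / a 2%N + beta <= t.

(** If t >= 2, the differences of a do not decrease while a is positive, so a increases. If t < 2, a
    failure at k would persist up to p and contradict [t_ge]. *)
Lemma linrec_lt2 k : (k < p)%N -> a k < a k.+2.
Proof.
have a2E : a 2%N = t + beta by rewrite /=; ring.
have a2_gt0 : 0 < t + beta by rewrite -a2E a_gt0.
have C_gt0 : 0 < C by rewrite /C ltr_pwDl // mulr_ge0 // ltW // a2E.
have [t_ge2|t_lt2] := leP 2 t.
  have a_lt n : (n <= p)%N -> a n < a n.+1.
    elim: n => [|n IHn] np; first by rewrite /=; have := beta_ge0; lra.
    have := IHn (ltnW np); rewrite linrecSS.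
    have an1 : 0 < a n.+1 by rewrite a_gt0 //; lia.
    have : 0 <= (t - 2) * a n.+1 by rewrite mulr_ge0 ?subr_ge0 // ltW.
    by lra.
  by move=> kp; rewrite (lt_trans (a_lt k _)) ?a_lt // ltnW.
move=> kp; rewrite ltNge; apply/negP => a_ge.
have t_gt0 : 0 < t.
  have ap := a_gt0 (k := p); have ap1 := a_gt0 (k := p.+1).
  have : 0 < a p / a p.+1 by rewrite divr_gt0 ?ap ?ap1 //; lia.
  have : 0 < 2 / a 2%N by rewrite divr_gt0 // a2E.
  by have := t_ge; lra.
(* The failure propagates up to [p], so a_p / a_(p+1) >= 2 / t; with [t_ge] this
   forces t >= 2. *)
have ratio d : (k + d < p)%N -> t * a (k + d).+1 <= 2 * a (k + d).
  elim: d => [|d IHd] kdp.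
    by move: a_ge; rewrite addn0 linrecSS; lra.
  have := IHd ltac:(lia); rewrite addnS.
  (* Since C > 0, we have a_(n+1)^2 > a_n a_(n+2), which carries the inequality from n to n + 1. *)
  have := linrec_casoratian (k + d).
  have a1 : 0 < a (k + d).+1 by rewrite a_gt0 //; lia.
  have a2 : 0 < a (k + d).+2 by rewrite a_gt0 //; lia.
  move: (a (k + d)%N) (a (k + d).+1) (a (k + d).+2) a1 a2 => b0 b1 b2 b1_gt0 b2_gt0 cas tle.
  have : t * b1 * b2 <= 2 * b0 * b2 by rewrite ler_pM2r.
  by move=> tle2; rewrite -(ler_pM2l b1_gt0); have := C_gt0; lra.
have tp : t * a p <= 2 * a p.-1.
  have kp1 : (k <= p.-1)%N by lia.
  by have := ratio (p.-1 - k)%N; rewrite subnKC // prednK //; apply.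
have rp : 2 / t <= a p / a p.+1.
  have ap1_gt0 : 0 < a p.+1 by rewrite a_gt0 // leqnn.
  rewrite ler_pdivlMr // mulrAC ler_pdivrMr //.
  have := linrecSS (- beta) 1 p.-1; rewrite prednK // => ->; lra.
have : 2 / t + 2 / (t + beta) + beta <= t.
  by have := t_ge; rewrite a2E; lra.
have -> : 2 / t + 2 / (t + beta) + beta =
    (2 * (t + beta) + 2 * t + beta * t * (t + beta)) / (t * (t + beta)).
  by field; rewrite !gt_eqF.
(* With denominators cleared this reads t (4 - t^2) + beta (2 + t beta) <= 0, impossible for 0 < t <
   2. *)
rewrite ler_pdivrMr ?mulr_gt0 // => ineq.
have : 0 < t * ((2 - t) * (2 + t)) by rewrite !mulr_gt0 ?subr_gt0 ?addr_gt0.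
have : 0 <= beta * (2 + t * beta) by rewrite mulr_ge0 // addr_ge0 // mulr_ge0 // ltW.
by lra.
Qed.

Lemma linrec_prod_lt i j : (i < j <= p)%N -> a i * a i.+1 < a j * a j.+1.
Proof.
case/andP; elim: j => // j IHj; rewrite ltnS => ij jp.
have step : a j * a j.+1 < a j.+1 * a j.+2.
  by rewrite mulrC ltr_pM2l ?linrec_lt2 // a_gt0 //; lia.
move: ij; rewrite leq_eqVlt => /predU1P[->//|ij].
by rewrite (lt_trans _ step) // IHj // ltnW.
Qed.

Lemma linrec_prod_le i j : (i <= j <= p)%N -> a i * a i.+1 <= a j * a j.+1.
Proof.
case/andP; rewrite leq_eqVlt => /predU1P[->//|ij] jp.
by rewrite ltW // linrec_prod_lt // ij.
Qed.

(* [e] is the shortfall of x at w_1 from the continuation of the pendent path at v. *)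
Lemma path_quotient_lt (q s : nat) (xu xv e : R) :
  (q + maxn s.+1 2 <= p)%N -> 0 < xu -> 0 < xv ->
  xv * (1 / a 2%N + beta) <= e ->
  xu = xv / a q.+1 * a (q.+1 + s)%N - e * U s ->
  xu ^+ 2 / (a p * a p.+1) < xv ^+ 2 / (a q.+1 * a q.+2).
Proof.
move=> qsp.
(* The bound q + 1 + s <= p allows comparing products at q + 1 + s and p; q + 1 < p gives strictness
   when s = 0. *)
have [q1p qs1p sp qp] : [/\ (q.+1 <= p)%N, (q.+1 + s <= p)%N, (s <= p)%N &
  (q.+1 < p)%N] by split; lia.
have pos k : (0 < k)%N -> (k <= p)%N -> 0 < a k.
  by move=> k_gt0 kp; rewrite a_gt0 // k_gt0 leqW.
move=> xu_gt0 xv_gt0 e_ge xuE.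
have A1 : 0 < a q.+1 by exact: pos.
have A2 : 0 < a q.+2 by exact: pos.
have ap : 0 < a p by exact: pos.
have ap1 : 0 < a p.+1 by rewrite a_gt0 // leqnn.
have a2_gt0 : 0 < a 2%N by rewrite a_gt0 // ltnS.
have X1 : 0 < a (q.+1 + s)%N by rewrite pos // addSn.
have C_gt0 : 0 < C by rewrite /C ltr_pwDl // mulr_ge0 // ltW.
have e_gt0 : 0 < e by rewrite (lt_le_trans _ e_ge) // mulr_gt0 // ltr_pwDl // divr_gt0.
have e_geC : xv * C <= a 2%N * e.
  have : a 2%N * (xv * (1 / a 2%N + beta)) <= a 2%N * e by rewrite ler_pM2l.
  by rewrite (_ : a 2%N * _ = xv * C) // /C; field; rewrite gt_eqF.
have U_ge0 : (0 < s)%N -> 0 < U s.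
  move=> s_gt0; rewrite -(pmulr_rgt0 _ C_gt0) (linrec_shift_casoratian 0) add0n.
  rewrite [a 1%N]/= [a 0%N]/= mulr1 mulNr opprK ltr_pwDl ?pos //.
  by rewrite mulr_ge0 // ltW // a_gt0 // ltnS.
have shift := linrec_shift_casoratian q.+1 s.
have prod12 : a 2%N <= a q.+1 * a q.+2.
  by have := @linrec_prod_le 1 q.+1; rewrite [a 1%N]/= mul1r; apply.
have := @linrec_prod_le (q.+1 + s) p; rewrite qs1p leqnn => /(_ isT) prodD.
rewrite ltr_pdivrMr ?mulr_gt0 // mulrAC ltr_pdivlMr ?mulr_gt0 //.
(* The shortfall at u, in the scale where x_v is a_(q+1). *)
pose Y := e * U s * a q.+1 / xv.
have xuY : xu * a q.+1 = xv * (a (q.+1 + s)%N - Y).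
  by rewrite xuE /Y; field; rewrite !gt_eqF.
have Y_lt : 0 < a (q.+1 + s)%N - Y by rewrite -(pmulr_rgt0 _ xv_gt0) -xuY mulr_gt0.
(* Here e >= x_v C / a_2, and a_2 = a_1 a_2 is at most a_(q+1) a_(q+2). *)
have YC : C * U s <= a q.+2 * Y.
  have U0 : 0 <= U s by case: (posnP s) => [->|/U_ge0/ltW].
  rewrite -(ler_pM2l xv_gt0).
  have -> : xv * (a q.+2 * Y) = (a q.+1 * a q.+2) * e * U s.
    by rewrite /Y; field; rewrite gt_eqF.
  rewrite mulrA ler_wpM2r //; apply: le_trans e_geC _.
  by rewrite ler_wpM2r // ltW.
rewrite -(ltr_pM2l A1).
have -> : a q.+1 * (xu ^+ 2 * (a q.+1 * a q.+2)) =
    xv ^+ 2 * ((a (q.+1 + s)%N - Y) ^+ 2 * a q.+2).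
  by rewrite [RHS]mulrA -exprMn -xuY; ring.
have -> : a q.+1 * (xv ^+ 2 * (a p * a p.+1)) = xv ^+ 2 * (a q.+1 * (a p * a p.+1)) by ring.
rewrite ltr_pM2l ?exprn_gt0 //.
case: (posnP s) => [s0|s_gt0].
  have Y0 : Y = 0 by rewrite /Y s0 /= mulr0 !mul0r.
  rewrite Y0 subr0 s0 addn0.
  have := @linrec_prod_lt q.+1 p; rewrite qp leqnn => /(_ isT) prod_lt.
  by rewrite expr2 -mulrA ltr_pM2l.
have Y_gt0 : 0 < Y by rewrite divr_gt0 // !mulr_gt0 // U_ge0.
apply: (@lt_le_trans _ _ (a q.+1 * (a (q.+1 + s)%N * a (q.+1 + s).+1))); last first.
  by rewrite ler_pM2l.
move: shift YC Y_lt X1 A2 Y_gt0.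
move: (a (q.+1 + s)%N) (a (q.+1 + s).+1) (a q.+2) (a q.+1) => X X2 B2 B1.
move=> -> YC Y_lt X1 B2_gt0 Y_gt0.
(* By [YC], B2 (X - Y) <= B1 X2; hence (X - Y)^2 B2 < X (X - Y) B2 <= X B1 X2. *)
have : X * (X * B2 - B1 * X2) <= X * (B2 * Y) by rewrite ler_pM2l.
have : 0 < (X - Y) * (B2 * Y) by rewrite mulr_gt0 // mulr_gt0.
by lra.
Qed.

End LinearRecurrence.

(** * Moving one vertex between the pendent paths *)

Section PendentPaths.
Variables (R : realType) (alpha r : R).
Hypothesis alpha01 : 0 <= alpha < 1.
Let beta := alpha / (1 - alpha).
Let t := (r - 2 * alpha) / (1 - alpha).
Local Notation a := (linrec t (- beta) 1).

Let al1 : 1 - alpha != 0.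
Proof. by rewrite subr_eq0 eq_sym lt_eqF //; case/andP: alpha01. Qed.

Let rE : r = (1 - alpha) * t + 2 * alpha.
Proof. by rewrite /t; field. Qed.

Let alE : alpha = (1 - alpha) * beta.
Proof. by rewrite /beta; field. Qed.

Lemma pendent_path_eigen (G : sgraph) (x : G) (m : nat) (f : attach_path x m -> R) :
  (forall i : 'I_m, alpha_op alpha f (inr i) = r * f (inr i)) ->
  exists c, (forall i : 'I_m, f (inr i) = c * a i.+1) /\ f (inl x) = c * a m.+1.
Proof.
move=> fE.
(* Out of range [F1] takes the value at the root, so that F m.+1 = f (inl x); index 0 of [F] is the
   virtual vertex. *)
pose F1 k := if insub k is Some i then f (inr (i : 'I_m)) else f (inl x).
pose F k : R := if k is k'.+1 then F1 k' else - beta * F1 0%N.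
have F_path (i : 'I_m) : f (inr i) = F i.+1 by rewrite /F /F1 valK.
have F_root : f (inl x) = F m.+1 by rewrite /F /F1 insubN // ltnn.
have F0 : F 0%N = - beta * F 1%N by [].
move: F F_path F_root F0 => {F1} F F_path F_root F0.
have F_end : alpha * F 1%N + (1 - alpha) * F 0%N = 0.
  by rewrite {1}alE F0; ring.
have Fa k : (k <= m.+1)%N -> F k = F 1%N * a k.
  apply: (@rec2_eq _ t F (fun k => F 1%N * a k) m.+1).
  - by rewrite F0 /=; ring.
  - by rewrite /= mulr1.
  - move=> i; rewrite ltnS => im; have := fE (Ordinal im).
    rewrite (alpha_op_inr F_path F_root F_end) F_path rE /= => /eqP.
    rewrite -subr_eq0 (_ : _ - _ = (1 - alpha) * (F i + F i.+2 - t * F i.+1)); last by ring.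
    by rewrite mulf_eq0 (negPf al1) /= => /eqP; lra.
  - by move=> i _; rewrite linrecSS; ring.
exists (F 1%N); split; last by rewrite F_root Fa.
by move=> i; rewrite F_path Fa // ltnS ltnW.
Qed.

(** Converse of [pendent_path_eigen], used to build the test vector. *)
Lemma pendent_path_op (G : sgraph) (x : G) (m : nat) (f : attach_path x m -> R) (c : R) :
  (forall i : 'I_m, f (inr i) = c * a i.+1) -> f (inl x) = c * a m.+1 ->
  (forall i : 'I_m, alpha_op alpha f (inr i) = r * f (inr i)) /\
  attach_term alpha f = (1 - alpha) * c * (beta * a m.+1 + a m).
Proof.
move=> f_path f_root.
have F_end : alpha * (c * a 1%N) + (1 - alpha) * (c * a 0%N) = 0.
  by rewrite {1}alE /=; ring.
split=> [i|]; last first.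
  by rewrite (@attach_termE _ _ _ _ _ _ (fun k => c * a k)) // {1}alE; ring.
rewrite (@alpha_op_inr _ _ _ _ _ _ (fun k => c * a k)) // f_path linrecSS rE; ring.
Qed.

Variables (G : sgraph) (u v : G).

(** The indicator form covers u = v, where the two path terms add up. *)
Lemma two_paths_op (p q : nat) (h : attach_two_paths u v p q -> R) (c d : R) :
  (forall i : 'I_p, h (inl (inr i)) = c * a i.+1) -> h (inl (inl u)) = c * a p.+1 ->
  (forall i : 'I_q, h (inr i) = d * a i.+1) -> h (inl (inl v)) = d * a q.+1 ->
  [/\ forall i, alpha_op alpha h (inl (inr i)) = r * h (inl (inr i)),
      forall i, alpha_op alpha h (inr i) = r * h (inr i) &
      forall z, alpha_op alpha h (inl (inl z)) =
        alpha_op alpha (fun z => h (inl (inl z))) z +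
        (1 - alpha) * ((z == u)%:R * (c * (beta * a p.+1 + a p)) +
                       (z == v)%:R * (d * (beta * a q.+1 + a q)))].
Proof.
move=> h_up h_u h_vp h_v.
have [Aup Tu] := @pendent_path_op G u p (fun z => h (inl z)) c h_up h_u.
have [Avp Tv] := @pendent_path_op (attach_path u p) (inl v) q h d h_vp h_v.
split=> // [i|z]; first by rewrite alpha_op_inl mul0r addr0 Aup.
by rewrite alpha_op_inl Tv (@alpha_op_inl _ _ _ _ _ (fun z => h (inl z))) Tu; ring.
Qed.

Lemma two_paths_eigen (p q : nat) (h : attach_two_paths u v p q -> R) :
  (forall z, alpha_op alpha h z = r * h z) ->
  exists c d, [/\ forall i : 'I_p, h (inl (inr i)) = c * a i.+1, h (inl (inl u)) = c * a p.+1,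
  forall i : 'I_q, h (inr i) = d * a i.+1 & h (inl (inl v)) = d * a q.+1].
Proof.
move=> hE.
have [|c [h_up h_u]] := @pendent_path_eigen G u p (fun z => h (inl z)).
  by move=> i; have := hE (inl (inr i)); rewrite alpha_op_inl mul0r addr0.
have [|d [h_vp h_v]] := @pendent_path_eigen (attach_path u p) (inl v) q h.
  by move=> i; exact: hE.
by exists c, d.
Qed.

Definition nbr_sum (f : G -> R) (z : G) : R := \sum_(y | z -- y) (f y + beta * f z).

Lemma alpha_op_nbr_sum f z : alpha_op alpha f z = (1 - alpha) * nbr_sum f z.
Proof.
by rewrite /nbr_sum mulr_sumr; apply: eq_bigr => y _; rewrite {1}alE; ring.
Qed.

End PendentPaths.

(** * From the Perron vector of one graph to a test vector on the other *)

Section Transfer.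
Variables (R : realType) (alpha : R) (G : sgraph) (u v : G) (p q : nat).
Hypothesis alpha01 : 0 <= alpha < 1.
Let r := rho alpha (attach_two_paths u v p.+1 q).
Let beta := alpha / (1 - alpha).
Let t := (r - 2 * alpha) / (1 - alpha).
Local Notation a := (linrec t (- beta) 1).

(** The long path has p + 1 vertices here. Positivity of the Perron vector on it and at u makes a_1,
    ..., a_(p+2) positive. *)
Lemma two_paths_perron : connected_graph G -> exists g : G -> R,
  [/\ forall z, 0 < g z, forall k, (1 <= k <= p.+2)%N -> 0 < a k,
    (q < p)%N -> forall z, (t + 2 * beta) * g z = nbr_sum alpha g z +
        (z == u)%:R * (g u * (beta + a p.+1 / a p.+2)) +
        (z == v)%:R * (g v * (beta + a q / a q.+1)) &
    (q < p)%N -> (g u) ^+ 2 / (a p.+1 * a p.+2) < (g v) ^+ 2 / (a q.+1 * a q.+2) ->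
    r < rho alpha (attach_two_paths u v p q.+1)].
Proof.
move=> conn; have [al0 al1] := andP alpha01.
have al1_neq0 : 1 - alpha != 0 by rewrite subr_eq0 gt_eqF.
have al1_gt0 : 0 < 1 - alpha by rewrite subr_gt0.
have conn2 : connected_graph (attach_two_paths u v p.+1 q).
  exact/attach_path_connected/attach_path_connected.
have [h h_gt0 hE] := @perron R alpha alpha01 (attach_two_paths u v p.+1 q) (inl (inl u)) conn2.
have [c [d [h_up h_u h_vp h_v]]] := two_paths_eigen alpha01 hE.
rewrite -/r -/beta -/t in hE h_up h_u h_vp h_v.
pose g z := h (inl (inl z)).
have g_gt0 z : 0 < g z by exact: h_gt0.
have c_gt0 : 0 < c by have := h_gt0 (inl (inr ord0)); rewrite h_up /= mulr1.
have a_gt0 k : (1 <= k <= p.+2)%N -> 0 < a k.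
  rewrite -(pmulr_rgt0 _ c_gt0); case: k => // k /andP[_].
  rewrite ltnS leq_eqVlt => /predU1P[->|kp].
    by rewrite -h_u.
  by have := h_gt0 (inl (inr (Ordinal kp))); rewrite h_up.
have [_ _ hG] := two_paths_op alpha01 h_up h_u h_vp h_v.
exists g; split=> // qp.
  have ap2 : 0 < a p.+2 by rewrite a_gt0 // leqnn.
  have aq1 : 0 < a q.+1 by rewrite a_gt0 //; lia.
  move=> z; apply: (mulfI al1_neq0); rewrite -/beta -/t in hG.
  have := hE (inl (inl z)); rewrite hG alpha_op_nbr_sum // -/(g z).
  have -> : c = g u / a p.+2 by rewrite /g h_u mulfK // gt_eqF.
  have -> : d = g v / a q.+1 by rewrite /g h_v mulfK // gt_eqF.
  have rE : r = (1 - alpha) * (t + 2 * beta) by rewrite /t /beta; field.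
  rewrite rE => e; rewrite [LHS]mulrA -e -mulrDr; congr (_ * _).
  by field; rewrite !gt_eqF.
move=> quot_lt.
have ap : 0 < a p by rewrite a_gt0 //; lia.
have ap1 : 0 < a p.+1 by rewrite a_gt0 //; lia.
have ap2 : 0 < a p.+2 by rewrite a_gt0 //; lia.
have aq1 : 0 < a q.+1 by rewrite a_gt0 //; lia.
have aq2 : 0 < a q.+2 by rewrite a_gt0 //; lia.
(* The new paths have p and q + 1 vertices, so their roots have index p + 1 and q + 2; the
   multipliers match g there. *)
pose c' := g u / a p.+1; pose d' := g v / a q.+2.
pose y (z : attach_two_paths u v p q.+1) : R := match z with
  | inl (inl z) => g z | inl (inr i) => c' * a i.+1 | inr i => d' * a i.+1 end.
have y_u : y (inl (inl u)) = c' * a p.+1 by rewrite /c' divfK // gt_eqF.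
have y_v : y (inl (inl v)) = d' * a q.+2 by rewrite /d' divfK // gt_eqF.
have [Yup Yvp YG] := @two_paths_op R alpha r alpha01 G u v p q.+1 y c' d'
  (fun=> erefl) y_u (fun=> erefl) y_v.
apply: (@alpha_op_gt_rho _ _ _ y); rewrite !big_sumType /=.
rewrite [X in _ + X + _]big1 ?addr0 => [|i _]; last by rewrite Yup subrr mulr0.
rewrite [X in _ + X]big1 ?addr0 => [|i _]; last by rewrite Yvp subrr mulr0.
pose C := 1 + beta * a 2%N.
have C_gt0 : 0 < C by rewrite /C ltr_pwDl // mulr_ge0 // ?divr_ge0 // ltW // a_gt0.
rewrite (eq_bigr (fun z => (1 - alpha) * C *
   ((z == v)%:R * (g v ^+ 2 / (a q.+1 * a q.+2)) -
    (z == u)%:R * (g u ^+ 2 / (a p.+1 * a p.+2))))).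
  rewrite -mulr_sumr sumrB !mulr_gt0 //.
  rewrite (bigD1 v) //= big1 ?eqxx ?mul1r ?addr0 => [|z /negPf->]; last by rewrite mul0r.
  rewrite (bigD1 u) //= big1 ?eqxx ?mul1r ?addr0 => [|z /negPf->]; last by rewrite mul0r.
  by rewrite subr_gt0.
move=> z _; rewrite YG -/(g z).
(* Trading r g z for the operator of the old graph cancels the part inside G and leaves only the
   changes of the path terms at u and v. *)
have := hE (inl (inl z)); rewrite hG -/g -/(g z) => <-.
have -> : c = g u / a p.+2 by rewrite /g h_u mulfK // gt_eqF.
have -> : d = g v / a q.+1 by rewrite /g h_v mulfK // gt_eqF.
rewrite -/beta -/t /c' /d'.
have Cp : C = a p.+1 ^+ 2 - a p * a p.+2 by rewrite linrec_casoratian.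
have Cq : C = a q.+1 ^+ 2 - a q * a q.+2 by rewrite linrec_casoratian.
have gu : g z * (z == u)%:R = g u * (z == u)%:R by case: eqP => [->//|_]; rewrite !mulr0.
have gv : g z * (z == v)%:R = g v * (z == v)%:R by case: eqP => [->//|_]; rewrite !mulr0.
have Du : g u / a p.+1 * (beta * a p.+1 + a p) - g u / a p.+2 * (beta * a p.+2 + a p.+1) =
    - g u * C / (a p.+1 * a p.+2).
  by rewrite Cp; field; rewrite !gt_eqF.
have Dv : g v / a q.+2 * (beta * a q.+2 + a q.+1) - g v / a q.+1 * (beta * a q.+1 + a q) =
    g v * C / (a q.+1 * a q.+2).
  by rewrite Cq; field; rewrite !gt_eqF.
have -> : forall S X X' V V' : R,
  g z * (S + (1 - alpha) * ((z == u)%:R * X' + (z == v)%:R * V') -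
        (S + (1 - alpha) * ((z == u)%:R * X + (z == v)%:R * V))) =
  (1 - alpha) * ((g z * (z == u)%:R) * (X' - X) + (g z * (z == v)%:R) * (V' - V)).
  by move=> *; ring.
rewrite Du Dv gu gv; ring.
Qed.

End Transfer.

(* MathComp world. [w] is the list w_1, ..., w_s, so w_i = nth v (v :: w) i. *)
Theorem theorem1 (R : realType) (G : sgraph) (u v : G) (s : nat) (w : seq G)
    (p q : nat) (alpha : R) :
  connected_graph G ->
  (2 <= deg u)%N -> (2 <= deg v)%N ->
  path sedge v w -> uniq (v :: w) -> size w = s -> last v w = u ->
  (forall i : nat, (1 <= i <= s.-1)%N -> deg (nth v (v :: w) i) = 2%N) ->
  0 <= alpha < 1 ->
  (maxn s.+1 2 <= p - q)%N ->
  rho alpha (attach_two_paths u v p.-1 q.+1) > rho alpha (attach_two_paths u v p q).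
Proof.
move=> conn deg_u deg_v w_path w_uniq w_size w_last w_deg alpha01 pq.
case: p pq => [|p] pq; first by move: pq; rewrite sub0n; lia.
have qsp : (q + maxn s.+1 2 <= p.+1)%N by lia.
have qp : (q < p)%N by lia.
have [g [g_gt0 a_gt0 gE transfer]] := two_paths_perron u v p q alpha01 conn.
have [al0 al1] := andP alpha01.
set r := rho _ _ in a_gt0 gE transfer *.
set beta := alpha / (1 - alpha) in a_gt0 gE transfer *.
set t := (r - 2 * alpha) / (1 - alpha) in a_gt0 gE transfer *.
set a := linrec t (- beta) 1 in a_gt0 gE transfer *.
apply: transfer => //; move: gE => /(_ qp) gE.
have beta_ge0 : 0 <= beta by rewrite divr_ge0 // subr_ge0 ltW.
have betaE : alpha / (1 - alpha) = beta by [].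
clearbody t beta.
have a2_gt0 : 0 < a 2%N by rewrite a_gt0.
have ap1_gt0 : 0 < a p.+1 by rewrite a_gt0 //= leqW.
have ap2_gt0 : 0 < a p.+2 by rewrite a_gt0 //= leqnn.
have aq1_gt0 : 0 < a q.+1 by rewrite a_gt0 //= !ltnS ltnW // ltnW.
have aq2_gt0 : 0 < a q.+2 by rewrite a_gt0 //= !ltnS ltnW.
have a2E : a 2%N = t + beta by rewrite /a /=; ring.
(* For q = 0 there is no path at v, and the term is beta + a_0 = 0. *)
have rq_ge : 0 <= beta + a q / a q.+1.
  move: aq1_gt0; case: (posnP q) => [->|q_gt0] aq1.
    by rewrite /a /= divr1 subrr.
  by rewrite addr_ge0 // divr_ge0 // ltW // a_gt0 // q_gt0 /= leqW // leqW // ltnW.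
have rp_ge : 0 <= beta + a p.+1 / a p.+2 by rewrite addr_ge0 // divr_ge0 // ltW.
have nbr_le z : nbr_sum alpha g z <= (t + 2 * beta) * g z.
  by rewrite gE -addrA lerDl; apply: addr_ge0; rewrite mulr_ge0 ?ler0n // mulr_ge0 // ltW.
have g_ge0 z : 0 <= g z by exact: ltW.
have nbr_term_ge0 z y : 0 <= g y + beta * g z by rewrite addr_ge0 ?mulr_ge0.
(* Keeping only the neighbour z in the equation at y gives g z <= (t + beta) g y = a_2 g y. *)
have nbr_ge z y : z -- y -> g z * (1 / a 2%N + beta) <= g y + beta * g z.
  move=> zy; suff : g z <= a 2%N * g y.
    rewrite mulrDr (mulrC (g z) beta) lerD2r mul1r ler_pdivrMr //.
    by rewrite (mulrC (g y)).
  have := nbr_le y; rewrite /nbr_sum betaE (bigD1 z) /=; last by rewrite sedge_sym.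
  have : 0 <= \sum_(i | (y -- i) && (i != z)) (g i + beta * g y).
    by apply: sumr_ge0 => i _.
  by rewrite a2E; lra.
have nbr_deg (P : pred G) z : (forall y, P y -> z -- y) ->
    #|P|%:R * (g z * (1 / a 2%N + beta)) <= \sum_(y | P y) (g y + beta * g z).
  move=> Pz; rewrite mulr_natl -sumr_const; apply: ler_sum => y Py.
  by apply: nbr_ge; exact: Pz.
have t_ge : a p.+1 / a p.+2 + 2 / a 2%N + beta <= t.
  have hu := gE u; rewrite eqxx mul1r in hu.
  have := nbr_deg (sedge u) u (fun y uy => uy).
  rewrite -betaE -/(nbr_sum alpha g u) betaE => deg_le.
  have : 2 * (g u * (1 / a 2%N + beta)) <= nbr_sum alpha g u.
    apply: le_trans deg_le; apply: ler_wpM2r.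
      by rewrite mulr_ge0 // addr_ge0 // divr_ge0 // ltW.
    by move: deg_u; rewrite /deg cardsE ler_nat.
  have : 0 <= (u == v)%:R * (g v * (beta + a q / a q.+1)).
    by rewrite !mulr_ge0 ?ler0n // ltW.
  move=> T1 T2; rewrite -(ler_pM2l (g_gt0 u)).
  have -> : g u * (a p.+1 / a p.+2 + 2 / a 2%N + beta) =
     2 * (g u * (1 / a 2%N + beta)) + g u * (beta + a p.+1 / a p.+2) - 2 * beta * g u.
    by field; rewrite !gt_eqF.
  by lra.
have [e e_ge g_uE] : exists2 e, g v * (1 / a 2%N + beta) <= e &
    g u = g v / a q.+1 * a (q.+1 + s)%N - e * linrec t 0 1 s.
  case: (posnP s) => [s0|s_gt0].
    (* For s = 0 the value of e is immaterial, as U_0 = 0. *)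
    exists (g v * (1 / a 2%N + beta)) => //.
    rewrite s0 addn0 mulr0 subr0 divfK ?gt_eqF //; congr g.
    by rewrite -w_last; move: w_size; rewrite s0 => /size0nil ->.
  have nth_edge i : (i < s)%N -> nth v (v :: w) i -- nth v (v :: w) i.+1.
    by move=> i_s; have /pathP := w_path; apply; rewrite w_size.
  have nth_inj i j : (i <= s)%N -> (j <= s)%N -> nth v (v :: w) i = nth v (v :: w) j -> i = j.
    by move=> i_s j_s /eqP; rewrite nth_uniq /= ?w_size ?ltnS // => /eqP.
  have u_nth : u = nth v (v :: w) s by rewrite -w_last (last_nth v) w_size.
  pose W i := nth v (v :: w) i.
  (* Continuing the pendent path at v would put g v a_(q+2) / a_(q+1) at w_1. By the equation at v,
     the shortfall e is the sum over the neighbours of v in G other than w_1, and there is at least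
     one. *)
  exists (g v * (a q.+2 / a q.+1) - g (W 1%N)).
    have hv := gE v; rewrite eqxx mul1r in hv.
    have vu : (v == u) = false.
      apply/eqP => vu; have := nth_inj 0%N s (leq0n s) (leqnn s).
      by rewrite -u_nth -vu => /(_ erefl) s0; move: s_gt0; rewrite -s0.
    rewrite vu mul0r addr0 in hv.
    have vw1 : v -- W 1%N by exact: (nth_edge 0%N).
    have := nbr_deg [pred y | (v -- y) && (y != W 1%N)] v (fun y => fun H => proj1 (andP H)).
    have card_ge : (1 <= #|[pred y | (v -- y) && (y != W 1%N)]|)%N.
      move: deg_v; rewrite /deg cardsE (cardD1 (W 1%N)) (_ : W 1%N \in sedge v) // add1n ltnS.
      move=> card_ge; apply: leq_trans card_ge _; apply: subset_leq_card.
      apply/fintype.subsetP => y.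
      by rewrite !inE andbC.
    move: hv; rewrite /nbr_sum betaE (bigD1 (W 1%N)) //= => hv nd.
    have : g v * (1 / a 2%N + beta) <= \sum_(i | (v -- i) && (i != W 1%N)) (g i + beta * g v).
      apply: le_trans nd; rewrite ler_peMl ?ler1n //.
      by rewrite mulr_ge0 // addr_ge0 // divr_ge0 // ltW.
    have -> : a q.+2 = t * a q.+1 - a q by exact: linrecSS.
    have -> : g v * ((t * a q.+1 - a q) / a q.+1) = g v * t - g v * (a q / a q.+1).
      by field; rewrite gt_eqF.
    by lra.
  rewrite u_nth; set e := g v * _ - _.
  (* Both sides agree at w_0 and w_1, and each inner w_i, having only its two path neighbours, obeys
     the recurrence. *)
  apply: (@rec2_eq _ t (fun i => g (W i))
    (fun i => g v / a q.+1 * a (q.+1 + i)%N - e * linrec t 0 1 i) s) => //.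
  - by rewrite addn0 mulr0 subr0 divfK // gt_eqF.
  - by rewrite addn1 /= mulr1 /e; field; rewrite gt_eqF.
  - move=> i i2s; have i1s : (i.+1 < s)%N by [].
    have := gE (W i.+1).
    have wu : (W i.+1 == u) = false.
      apply/eqP; rewrite u_nth => /(nth_inj _ _ (ltnW i1s) (leqnn s)) E.
      by rewrite E ltnn in i1s.
    have wv : (W i.+1 == v) = false.
      by apply/eqP => /(nth_inj i.+1 0%N (ltnW i1s) (leq0n s)).
    rewrite wu wv !mul0r !addr0.
    have w02 : W i != W i.+2.
      by apply/eqP => /(nth_inj _ _ (ltnW (ltnW i1s)) i1s)/eqP; rewrite ltn_eqF.
    have nbrs : [set y | W i.+1 -- y] = [set W i; W i.+2].
      have degW : #|[set y | W i.+1 -- y]| = 2%N.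
        by apply: (w_deg i.+1); rewrite /= -ltnS prednK.
      apply/esym/eqP; rewrite eqEcard cards2 w02 degW leqnn andbT.
      apply/fintype.subsetP => y; rewrite !inE => /orP[]/eqP->; last exact: nth_edge.
      by rewrite sedge_sym nth_edge // ltnW // ltnW.
    have -> : nbr_sum alpha g (W i.+1) =
        (g (W i) + beta * g (W i.+1)) + (g (W i.+2) + beta * g (W i.+1)).
      rewrite /nbr_sum betaE (eq_bigl (fun y => y \in [set W i; W i.+2]));
        last by move=> y; rewrite -nbrs inE.
      by rewrite big_setU1 ?inE //= big_set1.
    by lra.
  - by move=> i _; rewrite !addnS /a !linrecSS; ring.
exact: (path_quotient_lt beta_ge0 _ a_gt0 t_ge qsp _ _ e_ge g_uE).
Qed.
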